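(* Let $p$ be a large prime, let $k$ be a positive integer, let $N$ be a positive integer with $N<p$, let $I=[1,N]$, and let $\mathcal{P}$ be the set of prime numbers. Then the number $J_{2k}$ of solutions of the congruence $$x_1^*+\dots+x_k^*\equiv x_{k+1}^*+\dots+x_{2k}^*\pmod p,\qquad x_1,\dots,x_{2k}\in I\cap\mathcal{P},$$ satisfies $$J_{2k}<(2k)^{k}\left(\frac{N^{2k-1}}{p}+1\right)N^{k}.$$
   Context: $[1,N]$ denotes the set of integers $1,\dots,N$. For an integer $x$ coprime to $p$, $x^*$ denotes its multiplicative inverse modulo $p$. ''Large prime'' means $p\ge p_0$ for some absolute constant $p_0$ (independent of $k$ and $N$). *)

(* Defs.v *)
From mathcomp Require Import all_boot all_order all_algebra.

Set Implicit Arguments.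
Unset Strict Implicit.
Unset Printing Implicit Defensive.

Import GRing.Theory.
Local Open Scope ring_scope.

(* x^* as a residue class modulo p: congruences modulo p are equalities in 'F_p.
   Meaningful for p prime and x coprime to p. *)
Definition inv_mod (p x : nat) : 'F_p := (x%:R)^-1.

(* 'I_N.+1 is {0, ..., N}; the condition 0 < x i cuts it down to [1, N].
   The indices lshift k i and rshift k i, for i < k, are those of the first and
   of the last k of the 2k unknowns. *)
Definition solutions (p k N : nat) : {set {ffun 'I_(k + k) -> 'I_N.+1}} :=
  [set x : {ffun 'I_(k + k) -> 'I_N.+1} |
    [forall i, (0 < x i)%N && prime (x i)]
    && (\sum_(i < k) inv_mod p (x (lshift k i))
        == \sum_(i < k) inv_mod p (x (rshift k i)))].

Definition J2k (p k N : nat) : nat := #|solutions p k N|.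

(* Main.v *)
(* For z a k-tuple of primes at most N, let l be the sum of the inverses of its
   entries modulo p; J_2k is the sum over z of the number of prime k-tuples x
   with the same sum l, so it is enough to bound this number. Write the rational
   number sum_i 1/x_i as b/E in lowest terms and choose, among the k-tuples with
   sum l, a tuple y whose fraction a/D has the largest denominator. Then
   b D - a E = m p for an integer m with |m| <= k N^(2k-1) / p. Since D is coprime
   to a and E <= D, the integer m determines E, hence the fraction b/E. Finally a
   rational number is a sum of k inverses of primes in at most (2k)^(k-1) ways:
   a prime occurring in one representation but not in another one divides its
   multiplicity, hence is at most k, so that each entry takes at most 2k values;
   and k - 1 of the entries determine the remaining one. *)
Require Import Defs.
From mathcomp Require Import all_boot all_order all_algebra.
From mathcomp Require Import zify ring.

Set Implicit Arguments.
Unset Strict Implicit.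
Unset Printing Implicit Defensive.

Import Order.TTheory GRing.Theory Num.Theory.
Local Open Scope ring_scope.

(** Clearing denominators, over an arbitrary field since it serves both in [rat] and in ['F_p]. *)
Lemma mul_prod_sum_inv (F : fieldType) (I : finType) (P : pred I)
    (x : I -> nat) :
  (forall i, P i -> (x i)%:R != 0 :> F) ->
  (\prod_(i | P i) x i)%:R * (\sum_(i | P i) (x i)%:R^-1) =
  (\sum_(i | P i) \prod_(j | P j && (j != i)) x j)%:R :> F.
Proof.
move=> x0; rewrite natr_sum mulr_sumr; apply: eq_bigr => i Pi.
by rewrite (bigD1 i) //= natrM mulrAC mulfV ?mul1r ?x0.
Qed.

(** * Sums of inverses of primes as rational numbers *)

Section SumInv.
Variables (k N : nat).
Implicit Types x y : {ffun 'I_k -> 'I_N.+1}.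

Definition prime_tuples : {set {ffun 'I_k -> 'I_N.+1}} :=
  [set x : {ffun 'I_k -> 'I_N.+1} | [forall i, prime (x i)]].

Lemma prime_tuplesP x :
  reflect (forall i, prime (x i)) (x \in prime_tuples).
Proof. by rewrite inE; apply: forallP. Qed.

Lemma card_prime_tuples : (0 < k)%N -> (0 < N)%N -> (#|prime_tuples| < N ^ k)%N.
Proof.
move=> k0 N0.
pose S := [set i : 'I_N.+1 | prime i].
have SN : (#|S| < N)%N.
  (* Neither 0 nor 1 is prime, so at most N - 1 of the N + 1 elements of ['I_N.+1] remain. The final
     strict inequality comes from here. *)
  have/subset_leq_card: S \subset ~: [set ord0; inord 1].
    apply/subsetP => i; rewrite !inE => pi; apply/norP; split.
      by apply: contraTneq pi => ->.
    by apply: contraTneq pi => ->; rewrite inordK.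
  have := cardsC [set ord0; inord 1 : 'I_N.+1].
  rewrite cards2 -val_eqE /= inordK // card_ord add2n => -[eN] le.
  by rewrite -[ltnRHS]eN ltnS.
have/subset_leq_card: prime_tuples \subset ffun_on S.
  by apply/subsetP => x /prime_tuplesP xP; apply/ffun_onP => i; rewrite inE.
rewrite card_ffun_on card_ord => /leq_ltn_trans; apply.
by rewrite ltn_exp2r.
Qed.

Definition sum_inv x : rat := \sum_i (x i)%:R^-1.

Lemma sum_inv_ge0 x : 0 <= sum_inv x.
Proof. by apply: sumr_ge0 => i _; rewrite invr_ge0 ler0n. Qed.

Definition sum_inv_numer x : nat := (\sum_i \prod_(j | j != i) x j)%N.

Lemma sum_inv_frac x : x \in prime_tuples ->
  numq (sum_inv x) * (\prod_i x i)%N%:Z = (sum_inv_numer x)%:Z * denq (sum_inv x).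
Proof.
move=> /prime_tuplesP xP.
apply: (@intr_inj rat); rewrite !rmorphM /= numqE -!pmulrn.
have := @mul_prod_sum_inv rat 'I_k xpredT (fun i => x i) _.
rewrite -/(sum_inv x) /= => <-; first by rewrite mulrC mulrA.
by move=> i _; rewrite pnatr_eq0 -lt0n prime_gt0.
Qed.

(** The reduced denominator is coprime to the numerator, so it divides the common denominator
    [\prod_i x i]. *)
Lemma denq_sum_inv_le x : x \in prime_tuples ->
  (`|denq (sum_inv x)| <= N ^ k)%N.
Proof.
move=> xP; have/(congr1 absz) := sum_inv_frac xP; rewrite !abszM !absz_nat => e.
have dX : (`|denq (sum_inv x)| %| \prod_i x i)%N.
  by rewrite -(@Gauss_dvdr _ `|numq (sum_inv x)|) 1?coprime_sym ?coprime_num_den //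
     e dvdn_mull.
apply: leq_trans (dvdn_leq _ dX) _.
  by apply: prodn_gt0 => i; apply/prime_gt0/prime_tuplesP.
rewrite -[k in (_ ^ k)%N]card_ord -prod_nat_const.
by apply: leq_prod => i _; rewrite -ltnS.
Qed.

Lemma numq_sum_inv_le x : x \in prime_tuples ->
  (`|numq (sum_inv x)| <= k * N ^ k.-1)%N.
Proof.
move=> xP; have/(congr1 absz) := sum_inv_frac xP; rewrite !abszM !absz_nat => e.
have dX : (`|numq (sum_inv x)| %| sum_inv_numer x)%N.
  by rewrite -(@Gauss_dvdl _ _ `|denq (sum_inv x)|) ?coprime_num_den //
     -e dvdn_mulr.
have numer_le : (sum_inv_numer x <= k * N ^ k.-1)%N.
  rewrite -[k in (k * _)%N]card_ord -sum_nat_const; apply: leq_sum => i _.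
  rewrite -[k in (_ ^ k.-1)%N]card_ord -(cardC1 i) -prod_nat_const.
  by apply: leq_prod => j _; rewrite -ltnS.
(* Divisibility bounds [numq] only by a positive number; if the unreduced numerator is 0, then so is
   [numq]. *)
case: (posnP (sum_inv_numer x)) => [c0|c0]; last exact: leq_trans (dvdn_leq c0 dX) _.
move: e; rewrite c0 mul0n => /eqP; rewrite muln_eq0 => /orP[/eqP->//|].
rewrite -leqn0 leqNgt => /negP[]; apply: prodn_gt0 => i.
exact/prime_gt0/prime_tuplesP.
Qed.

(** Put q = [x i], of multiplicity t in [x]. Isolating the terms 1/q gives t/q + a/V = b/Y with V
    and Y coprime to q; clearing denominators shows that q divides t, and 0 < t <= k. *)
Lemma sum_inv_eq_prime_le x y i :
    x \in prime_tuples -> y \in prime_tuples -> sum_inv x = sum_inv y ->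
  x i \notin codom y -> (x i <= k)%N.
Proof.
move=> /prime_tuplesP xP /prime_tuplesP yP exy xiy; set q := x i.
have nz (z : nat) : prime z -> z%:R != 0 :> rat.
  by move=> pz; rewrite pnatr_eq0 -lt0n prime_gt0.
pose t := #|[pred j | x j == q]|.
pose V := (\prod_(j | x j != q) x j)%N; pose Y := (\prod_j y j)%N.
have eX := @mul_prod_sum_inv rat 'I_k [pred j | x j != q] (fun i => x i) (fun j _ => nz _ (xP j)).
have eY := @mul_prod_sum_inv rat 'I_k xpredT (fun i => y i) (fun j _ => nz _ (yP j)).
move: eX eY; rewrite -/(sum_inv y) /= -/V -/Y.
set a := (\sum_(_ | _) _)%N; set b := (\sum_(_ | _) _)%N => eX eY.
have ex : sum_inv x = t%:R / q%:R + \sum_(j | x j != q) (x j)%:R^-1.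
  rewrite /sum_inv (bigID (fun j => x j == q)) /=; congr (_ + _).
  rewrite (eq_bigr (fun=> q%:R^-1)) => [|j /eqP-> //].
  by rewrite sumr_const mulr_natl.
have e : ((t * V * Y + q * (a * Y) = q * (b * V)))%N.
  apply/eqP; rewrite -(eqr_nat rat) natrD !natrM -eX -eY -exy ex.
  have q0 : q%:R != 0 :> rat by apply/nz/xP.
  by apply/eqP; field.
have : (q %| t * V * Y)%N.
  by rewrite -(@dvdn_addl (q * (a * Y))) ?dvdn_mulr // e dvdn_mulr.
have cop z : z != q -> prime z -> coprime q z.
  by move=> zq pz; rewrite prime_coprime ?xP // dvdn_prime2 ?xP // eq_sym.
have cV : coprime q V.
  rewrite /V; elim/big_rec: _ => [|j m]; first exact: coprimen1.
  by move=> jq qm; rewrite coprimeMr cop ?xP.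
have cY : coprime q Y.
  rewrite /Y; elim/big_rec: _ => [|j m]; first exact: coprimen1.
  move=> _ qm; rewrite coprimeMr cop ?yP //.
  apply: contraNneq xiy => e1; have -> : x i = y j by apply: val_inj; rewrite /= e1.
  exact: codom_f.
rewrite Gauss_dvdl // Gauss_dvdl // => /dvdn_leq qt.
apply: leq_trans (qt _) _; first by apply/card_gt0P; exists i; rewrite inE.
by rewrite -[leqRHS]card_ord max_card.
Qed.

End SumInv.

Lemma card_sum_inv_eq k N (y : {ffun 'I_k -> 'I_N.+1}) : (0 < k)%N -> y \in prime_tuples k N ->
  (#|[set x in prime_tuples k N | sum_inv x == sum_inv y]| <= (2 * k) ^ k.-1)%N.
Proof.
case: k y => // k' y _ yP.
(* The candidate values of an entry: those of [y] and the integers from 1 to k. If some [i.+1]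
   exceeds N, [inord] returns a default value, which is harmless for an upper bound on [#|S|]. *)
pose S := [set i in codom y] :|: [set inord i.+1 | i : 'I_k'.+1].
have S2k : (#|S| <= 2 * k'.+1)%N.
  rewrite mul2n -addnn; apply: leq_trans (leq_card_setU _ _) _; apply: leq_add.
    rewrite cardsE; apply: leq_trans (card_size _) _.
    by rewrite size_codom card_ord.
  by apply: leq_trans (leq_imset_card _ _) _; rewrite card_ord.
pose A := [set x in prime_tuples k'.+1 N | sum_inv x == sum_inv y].
have AS x i : x \in A -> x i \in S.
  move=> /setIdP[xP /eqP xy]; rewrite !inE.
  have [//|/= yi] := boolP (x i \in codom y).
  have xik := sum_inv_eq_prime_le xP yP xy yi.
  have xi0 : (0 < x i)%N by apply/prime_gt0/(prime_tuplesP _ xP).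
  have xik' : ((x i).-1 < k'.+1)%N by rewrite prednK.
  by apply/imsetP; exists (Ordinal xik') => //=; rewrite prednK // inord_val.
(* Dropping the first entry loses nothing, since the prescribed sum recovers it. *)
pose r (x : {ffun 'I_k'.+1 -> 'I_N.+1}) := [ffun i : 'I_k' => x (lift ord0 i)].
have r_inj : {in A &, injective r}.
  move=> x z /setIdP[/prime_tuplesP xP /eqP ex].
  move=> /setIdP[/prime_tuplesP zP /eqP ez] exz.
  have lift_eq i : x (lift ord0 i) = z (lift ord0 i).
    by have := congr1 (fun f : {ffun _ -> _} => f i) exz; rewrite !ffunE.
  have : sum_inv x = sum_inv z by rewrite ex ez.
  rewrite /sum_inv !big_ord_recl (eq_bigr (fun i => (z (lift ord0 i))%:R^-1)).
    move=> /addIr /invr_inj /eqP; rewrite eqr_nat => /eqP e0.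
    by apply/ffunP => i; case: (unliftP ord0 i) => [j|] ->; last exact: val_inj.
  by move=> i _; rewrite lift_eq.
rewrite -/A -(card_in_imset r_inj).
apply: leq_trans (_ : (#|S| ^ k' <= _)%N); last first.
  by case: (posnP k') => [->|k'0] //; rewrite leq_exp2r.
rewrite -[k' in (_ ^ k')%N]card_ord -card_ffun_on.
apply/subset_leq_card/subsetP => _ /imsetP[x xA ->].
by apply/ffun_onP => i; rewrite ffunE AS.
Qed.

(** * Counting prime tuples with a given sum of inverses modulo p *)

Section ModP.
Variables p k N : nat.
Hypotheses (p_prime : prime p) (ltNp : (N < p)%N).
Implicit Types x y : {ffun 'I_k -> 'I_N.+1}.

Definition sum_inv_mod x : 'F_p := \sum_i inv_mod p (x i).

(** All entries are primes at most N < p, so their product is invertible modulo p and the rational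
    identity can be reduced. *)
Lemma numq_sum_inv_mod x : x \in prime_tuples k N ->
  (numq (sum_inv x))%:~R = (denq (sum_inv x))%:~R * sum_inv_mod x :> 'F_p.
Proof.
move=> xP.
have nz (z : 'I_N.+1) : prime z -> z%:R != 0 :> 'F_p.
  move=> pz; rewrite -(dvdn_pcharf (pchar_Fp p_prime)) gtnNdvd ?prime_gt0 //.
  by apply: leq_trans ltNp; rewrite ltnS -ltnS.
have e := @mul_prod_sum_inv 'F_p 'I_k xpredT (fun i => x i)
  (fun i _ => nz _ (prime_tuplesP _ xP i)).
have X0 : (\prod_i x i)%N%:R != 0 :> 'F_p.
  by rewrite natr_prod; apply/prodf_neq0 => i _; apply/nz/(prime_tuplesP _ xP).
apply: (mulIf X0); have := congr1 (intr : int -> 'F_p) (sum_inv_frac xP).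
by rewrite !rmorphM /= -!pmulrn -e /sum_inv_mod => ->; ring.
Qed.

Lemma card_sum_inv_mod (l : 'F_p) : (0 < k)%N ->
  (#|[set x in prime_tuples k N | sum_inv_mod x == l]|
     <= (2 * (k * N ^ (2 * k - 1) %/ p)).+1 * (2 * k) ^ k.-1)%N.
Proof.
move=> k0; set A := [set x in _ | _]; set B := (k * _)%N; set M := (B %/ p)%N.
have [->|/set0Pn[x0 x0A]] := eqVneq A set0; first by rewrite cards0.
have [y yA ymax] := arg_maxnP (fun x => `|denq (sum_inv x)|%N) x0A.
have AP x : x \in A -> x \in prime_tuples k N by case/setIdP.
set a := numq (sum_inv y); set D := denq (sum_inv y).
pose d x := numq (sum_inv x) * D - a * denq (sum_inv x).
have D0 : 0 < D by apply: denq_gt0.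
have dp x : x \in A -> (p %| d x)%Z.
  have yl : sum_inv_mod y = l by case/setIdP: yA => _ /eqP.
  move=> /setIdP[xP /eqP xl].
  rewrite (dvdz_pcharf (pchar_Fp p_prime)) rmorphB !rmorphM /= /a.
  by rewrite numq_sum_inv_mod // numq_sum_inv_mod ?AP // xl yl -/D; apply/eqP; ring.
(* Both products in [d x] lie in [0, B], so their difference is at most B in absolute value, with no
   factor 2. *)
have numB x z : x \in A -> z \in A ->
    0 <= numq (sum_inv x) * denq (sum_inv z) <= B%:Z.
  move=> xA zA.
  have u0 : 0 <= numq (sum_inv x) * denq (sum_inv z).
    by rewrite mulr_ge0 ?denq_ge0 // numq_ge0 sum_inv_ge0.
  rewrite u0 -[_ * _]ger0_norm // -abszE lez_nat abszM.
  have -> : B = (k * N ^ k.-1 * N ^ k)%N.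
    by rewrite -mulnA -expnD /B mul2n -addnn; case: (k) k0 => // n _; rewrite addSn subn1.
  by apply: leq_mul; [apply: numq_sum_inv_le|apply: denq_sum_inv_le]; apply: AP.
have dB x : x \in A -> `|d x| <= B%:Z.
  move=> xA; have := numB _ _ xA yA; have := numB _ _ yA xA.
  by rewrite /d -/a -/D; lia.
have d_inj : {in A &, forall x z, d x = d z -> sum_inv x = sum_inv z}.
  move=> x z xA zA dxz.
  have De : D * (numq (sum_inv x) - numq (sum_inv z)) =
            a * (denq (sum_inv x) - denq (sum_inv z)).
    by move: dxz; rewrite /d; lia.
  (* [D] is coprime to [a]. Both denominators lie in [1, D] by maximality of [y], so a difference
     divisible by [D] vanishes. *)
  have Dden : (D %| denq (sum_inv x) - denq (sum_inv z))%Z.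
    rewrite -(@Gauss_dvdzr _ a) -?De ?dvdz_mulr //.
    by rewrite coprimezE coprime_sym coprime_num_den.
  have den_eq : denq (sum_inv x) = denq (sum_inv z).
    have [ux uz] : denq (sum_inv x) <= D /\ denq (sum_inv z) <= D.
      have /= := ymax _ xA; have /= := ymax _ zA; rewrite -/D.
      have := denq_gt0 (sum_inv x); have := denq_gt0 (sum_inv z).
      by move: D0; lia.
    have := denq_gt0 (sum_inv x); have := denq_gt0 (sum_inv z).
    move: ux uz; case/dvdzP: Dden => c; rewrite -/D => ec ux uz z0 x0'.
    have : c = 0 by apply/eqP; rewrite eq_le; apply/andP; split; nia.
    by lia.
  have num_eq : numq (sum_inv x) = numq (sum_inv z).
    move/eqP: De; rewrite den_eq subrr mulr0 mulf_eq0 gt_eqF //= subr_eq0.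
    by move/eqP.
  by rewrite -[LHS]divq_num_den den_eq num_eq divq_num_den.
have p0 := prime_gt0 p_prime.
pose m x := (d x %/ p)%Z.
have mp x : x \in A -> d x = m x * p by move=> xA; rewrite /m divzK ?dp.
have mM x : x \in A -> `|m x| <= M%:Z.
  move=> xA; rewrite -abszE lez_nat leq_divRL //.
  by have := dB x xA; rewrite mp // -abszE lez_nat abszM.
(* Shifting by [M] moves the range [-M, M] of [m] to [0, 2M], so [inord] never takes its default
   value on [A]. *)
pose f x : 'I_(2 * M).+1 := inord `|M%:Z + m x|.
have f_inj : {in A &, forall x z, f x = f z -> sum_inv x = sum_inv z}.
  move=> x z xA zA /(congr1 val) /=; have Mx := mM x xA; have Mz := mM z zA.
  rewrite !inordK; [move=> e | lia | lia].
  by apply: d_inj => //; rewrite !mp //; congr (_ * _); lia.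
rewrite -sum1_card (partition_big f xpredT) //=.
rewrite -[X in (_ <= X * _)%N]card_ord -sum_nat_const.
apply: leq_sum => i _; rewrite sum1_card -cardsE.
have [->|/set0Pn[z]] := eqVneq [set x | (x \in A) && (f x == i)] set0.
  by rewrite cards0.
rewrite inE => /andP[zA /eqP fz].
apply: leq_trans (card_sum_inv_eq k0 (AP _ zA)); apply/subset_leq_card/subsetP.
move=> x; rewrite inE => /andP[xA /eqP fx].
by rewrite inE AP //=; apply/eqP/f_inj; rewrite // fx fz.
Qed.
End ModP.

(** * From tuples to solutions of the congruence *)

Lemma J2k_le p k N : prime p -> (N < p)%N -> (0 < k)%N ->
  (J2k p k N <= #|prime_tuples k N| *
     ((2 * (k * N ^ (2 * k - 1) %/ p)).+1 * (2 * k) ^ k.-1))%N.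
Proof.
move=> p_prime ltNp k0.
pose lft (x : {ffun 'I_(k + k) -> 'I_N.+1}) := [ffun i => x (lshift k i)].
pose rgt (x : {ffun 'I_(k + k) -> 'I_N.+1}) := [ffun i => x (rshift k i)].
have solP x : x \in solutions p k N ->
    [/\ lft x \in prime_tuples k N, rgt x \in prime_tuples k N &
        sum_inv_mod p (lft x) = sum_inv_mod p (rgt x)].
  rewrite inE => /andP[/forallP xP /eqP e].
  split.
  - by apply/prime_tuplesP => i; rewrite ffunE; case/andP: (xP (lshift k i)).
  - by apply/prime_tuplesP => i; rewrite ffunE; case/andP: (xP (rshift k i)).
  apply: etrans (etrans e _); last by apply: eq_bigr => i _; rewrite ffunE.
  by apply: eq_bigr => i _; rewrite ffunE.
rewrite /J2k -sum1_card (partition_big rgt (mem (prime_tuples k N))) /=; last first.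
  by move=> x /solP[].
rewrite -sum_nat_const; apply: leq_sum => z _; rewrite sum1_card -cardsE.
apply: leq_trans (card_sum_inv_mod p_prime ltNp (sum_inv_mod p z) k0).
(* Once the right half is fixed to [z], a solution is determined by its left half. *)
rewrite -(@card_in_imset _ _ lft) => [|x y]; last first.
  rewrite !inE => /andP[_ /eqP <-] /andP[_ /eqP exy] lxy.
  apply/ffunP => i; rewrite -(splitK i); case: (split i) => j /=.
    by have := congr1 (fun f : {ffun _ -> _} => f j) lxy; rewrite !ffunE.
  by have := congr1 (fun f : {ffun _ -> _} => f j) exy; rewrite !ffunE.
apply/subset_leq_card/subsetP => _ /imsetP[x + ->].
by rewrite inE => /andP[/solP[lP _ e] /eqP <-]; apply/setIdP; rewrite e.
Qed.

Theorem theorem6 :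
  exists p0 : nat, forall p k N : nat,
    prime p -> (p0 <= p)%N -> (0 < k)%N -> (0 < N)%N -> (N < p)%N ->
    ((J2k p k N)%:R : rat) <
      (2 * k)%:R ^+ k * (N%:R ^+ (2 * k - 1) / p%:R + 1) * N%:R ^+ k.
Proof.
exists 0%N => p k N p_prime _ k0 N0 ltNp.
have p0 : 0 < p%:R :> rat by rewrite ltr0n prime_gt0.
set B := (N ^ (2 * k - 1))%N; set M := (k * B %/ p)%N.
have C0 : (0 < (2 * M).+1 * (2 * k) ^ k.-1)%N.
  by rewrite muln_gt0 expn_gt0 muln_gt0 k0.
have Jlt : (J2k p k N < N ^ k * ((2 * M).+1 * (2 * k) ^ k.-1))%N.
  apply: leq_ltn_trans (J2k_le p_prime ltNp k0) _.
  by rewrite ltn_pmul2r // card_prime_tuples.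
rewrite -(ltr_nat rat) in Jlt; apply: lt_le_trans Jlt _.
rewrite natrM natrX mulrC ler_wpM2r ?exprn_ge0 //.
(* One factor 2k is set apart to absorb 2M + 1: since M <= kB/p and 1 <= 2k, 2M + 1 <= 2k (B/p +
   1). *)
have -> : (2 * k)%:R ^+ k = (2 * k)%:R ^+ k.-1 * (2 * k)%:R :> rat.
  by rewrite -exprSr prednK.
rewrite natrM natrX mulrC -mulrA.
rewrite ler_wpM2l ?exprn_ge0 // -natrX -/B.
have MB : M%:R <= k%:R * (B%:R / p%:R) :> rat.
  by rewrite mulrA ler_pdivlMr // -!natrM ler_nat leq_trunc_div.
rewrite -addn1 natrD !natrM mulrDr mulr1 -mulrA lerD ?ler_wpM2l //.
by rewrite -natrM ler1n muln_gt0.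
Qed.
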